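(* Let $q\ge1$. If $F\in\mathscr{G}$, then there exists a constant $C$ such that $$|F(\mathscr{B}_1)-F(\mathscr{B}_2)|\le C\,\mathrm{d}_q(\mathscr{B}_1,\mathscr{B}_2)$$ for every pair of barcodes $\mathscr{B}_1$ and $\mathscr{B}_2$, where $\mathrm{d}_q$ is the $q$-th Wasserstein distance.
   Context: Barcodes: an interval is encoded as $(x,d)$, with left endpoint $x\ge0$ and length $d\ge0$. $B_n$ is the orbit space of $([0,\infty)\times[0,\infty))^n$ under the action of $S_n$ permuting the $n$ pairs. The barcode space is $B=\coprod_nB_n/_\sim$, where $\sim$ is generated by $\{(x_1,d_1),\dots,(x_n,d_n)\}\sim\{(x_1,d_1),\dots,(x_{n-1},d_{n-1})\}$ whenever $d_n=0$. Wasserstein distance: for intervals put $\mathrm{d}_\infty((x_1,d_1),(x_2,d_2))=\max(|x_1-x_2|,|d_1-d_2+x_1-x_2|)$, and let the distance from an interval to the set $\Delta$ of zero-length intervals be $\mathrm{d}_\infty((x,d),\Delta)=d/2$. For barcodes $\mathscr{B}_1=\{I_\alpha\}_{\alpha\in A}$, $\mathscr{B}_2=\{J_\beta\}_{\beta\in B}$ ($A,B$ finite index sets), a real $q\ge1$ and a bijection $\theta:A'\to B'$ with $A'\subseteq A$, $B'\subseteq B$, let $P_q(\theta)=\sum_{a\in A'}\mathrm{d}_\infty(I_a,J_{\theta(a)})^q+\sum_{a\in A\setminus A'}\mathrm{d}_\infty(I_a,\Delta)^q+\sum_{b\in B\setminus B'}\mathrm{d}_\infty(J_b,\Delta)^q$.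 Then $\mathrm{d}_q(\mathscr{B}_1,\mathscr{B}_2)=(\min_\theta P_q(\theta))^{1/q}$ over all such $\theta$. The functions $E$: for $e=((e_{1,1},e_{1,2}),\dots,(e_{n,1},e_{n,2}))$, a nonzero $n\times2$ matrix with entries in $\{0,1\}$, let $\sigma_e(y_1,d_1,\dots,y_n,d_n)=\max_{\pi\in S_n}\sum_{i=1}^n(e_{\pi(i),1}y_i+e_{\pi(i),2}d_i)$. For a positive integer $m$ put $E_{m,e}(x_1,d_1,\dots,x_n,d_n)=\sigma_e(\min(x_1,md_1),d_1,\dots,\min(x_n,md_n),d_n)$. For nonnegative integers $k,l,p$, not all zero, $E_{m,(1,0)^k(0,1)^l(1,1)^p}$ denotes the function on $B$ whose value on a barcode represented by $n\ge k+l+p$ intervals is $E_{m,e}$, with $e$ having $k$ rows $(1,0)$, $l$ rows $(0,1)$, $p$ rows $(1,1)$ and $n-k-l-p$ rows $(0,0)$; barcodes with fewer intervals are first padded with zero-length intervals $(0,0)$. $\mathscr{G}$ is the set of functions on $B$ obtained from the functions $E_{m,(1,0)^k(0,1)^l(1,1)^p}$ by finitely many operations of taking maxima, adding and subtracting. *)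

(* Defs.v *)
From HB Require Import structures.
From mathcomp Require Import all_boot all_order all_algebra all_fingroup.
From mathcomp Require Import generic_quotient interval_inference.
From mathcomp Require Import boolp reals exp.
From mathcomp Require Import ring lra.
From Stdlib Require Import Relation_Operators.
Set Implicit Arguments.
Unset Strict Implicit.
Unset Printing Implicit Defensive.
Import Order.TTheory GRing.Theory Num.Theory.
Local Open Scope ring_scope.
Local Open Scope quotient_scope.

(* An interval is the pair (left endpoint, length). *)
Definition bar (R : realType) : Type := ({nonneg R} * {nonneg R})%type.

Definition left_end (R : realType) (I : bar R) : R := I.1%:num.
Definition len (R : realType) (I : bar R) : R := I.2%:num.

(* The disjoint union over n of the n-tuples of intervals is the type of finite
   sequences; dividing by S_n and then by ~ amounts to dividing by the
   equivalence relation generated by both kinds of identification. *)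
Inductive barcode_step (R : realType) : seq (bar R) -> seq (bar R) -> Prop :=
| BarcodePerm s t : perm_eq s t -> barcode_step s t
| BarcodeDrop s I : len I = 0 -> barcode_step (rcons s I) s.

Definition barcode_eq (R : realType) : rel (seq (bar R)) :=
  fun s t => `[< clos_refl_sym_trans _ (@barcode_step R) s t >].

Lemma barcode_eq_refl (R : realType) : reflexive (@barcode_eq R).
Proof. by move=> s; apply/asboolP; apply: rst_refl. Qed.

Lemma barcode_eq_sym (R : realType) : symmetric (@barcode_eq R).
Proof.
by move=> s t; apply/asboolP/asboolP; apply: rst_sym.
Qed.

Lemma barcode_eq_trans (R : realType) : transitive (@barcode_eq R).
Proof.
move=> t s u /asboolP st /asboolP tu; apply/asboolP; exact: rst_trans st tu.
Qed.

Canonical barcode_equiv (R : realType) :=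
  EquivRel (@barcode_eq R) (@barcode_eq_refl R) (@barcode_eq_sym R)
    (@barcode_eq_trans R).

Definition barcode (R : realType) : Type := {eq_quot (@barcode_equiv R)}.
HB.instance Definition _ (R : realType) := Quotient.on (barcode R).
HB.instance Definition _ (R : realType) := Choice.on (barcode R).

Definition bars (R : realType) (s : seq (bar R)) : 'I_(size s) -> bar R :=
  fun i => tnth (in_tuple s) i.

Section Wasserstein.
Variable R : realType.

Definition dinfty (I J : bar R) : R :=
  Num.max `|left_end I - left_end J|
          `|len I - len J + left_end I - left_end J|.

Definition dinfty_diag (I : bar R) : R := len I / 2.

(* A bijection between a subset of A and a subset of B, given by its graph. *)
Definition partial_bij (A B : finType) (th : {set A * B}) : Prop :=
  {in th &, injective fst} /\ {in th &, injective snd}.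

Definition matching_cost (q : R) (A B : finType) (I : A -> bar R)
    (J : B -> bar R) (th : {set A * B}) : R :=
  \sum_(ab in th) dinfty (I ab.1) (J ab.2) `^ q
  + \sum_(a | a \notin fst @: th) dinfty_diag (I a) `^ q
  + \sum_(b | b \notin snd @: th) dinfty_diag (J b) `^ q.

(* The minimum ranges over a finite nonempty set: the default value is the one
   at the empty partial bijection. *)
Definition wasserstein_fam (q : R) (A B : finType) (I : A -> bar R)
    (J : B -> bar R) : R :=
  (\big[Num.min/matching_cost q I J set0]_(th : {set A * B}
      | `[< partial_bij th >]) matching_cost q I J th) `^ q^-1.

(* Independent of the representatives: see wassersteinE below. *)
Definition wasserstein (q : R) (b1 b2 : barcode R) : R :=
  wasserstein_fam q (@bars R (repr b1)) (@bars R (repr b2)).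

End Wasserstein.

Section Functions.
Variable R : realType.

Definition sigma_val (n : nat) (e : 'M[bool]_(n, 2)) (y d : 'I_n -> R)
    (p : 'S_n) : R :=
  \sum_(i < n) ((e (p i) 0)%:R * y i + (e (p i) 1)%:R * d i).

Definition sigma (n : nat) (e : 'M[bool]_(n, 2)) (y d : 'I_n -> R) : R :=
  \big[Num.max/sigma_val e y d 1%g]_(p : 'S_n) sigma_val e y d p.

Definition Ecoord (n m : nat) (e : 'M[bool]_(n, 2)) (x d : 'I_n -> R) : R :=
  sigma e (fun i => Num.min (x i) (m%:R * d i)) d.

(* The order of the rows is irrelevant, as sigma is a maximum over S_n. *)
Definition emx (n k l p : nat) : 'M[bool]_(n, 2) :=
  \matrix_(i < n, j < 2)
    if (i < k)%N then j == 0
    else if (i < k + l)%N then j == 1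
    else (i < k + l + p)%N.

Definition bar0 : bar R := (0%:nng, 0%:nng).

Definition pad (n : nat) (s : seq (bar R)) : seq (bar R) :=
  s ++ nseq (n - size s) bar0.

Definition Eseq (m k l p : nat) (s : seq (bar R)) : R :=
  let t := pad (k + l + p) s in
  Ecoord m (emx (size t) k l p) (fun i => left_end (bars i))
    (fun i => len (bars i)).

(* Independent of the representative: see EfunE below. *)
Definition Efun (m k l p : nat) (b : barcode R) : R := Eseq m k l p (repr b).

Inductive in_G : (barcode R -> R) -> Prop :=
| G_E m k l p : (0 < m)%N -> (0 < k + l + p)%N -> in_G (Efun m k l p)
| G_max F1 F2 : in_G F1 -> in_G F2 -> in_G (fun b => Num.max (F1 b) (F2 b))
| G_add F1 F2 : in_G F1 -> in_G F2 -> in_G (fun b => F1 b + F2 b)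
| G_sub F1 F2 : in_G F1 -> in_G F2 -> in_G (fun b => F1 b - F2 b).

End Functions.

Section Welldef.
Variable R : realType.
Implicit Types (s t : seq (bar R)) (I J : bar R).

Lemma bars_nth (I0 : bar R) s (i : 'I_(size s)) : bars i = nth I0 s i.
Proof. by rewrite /bars (tnth_nth I0). Qed.

Lemma barcode_eq_lift (T : Type) (f : seq (bar R) -> T) :
  (forall s t, barcode_step s t -> f s = f t) ->
  forall s t, barcode_eq s t -> f s = f t.
Proof.
move=> fst s t /asboolP; elim=> {s t} [s t /fst //|//|s t _ -> //|s t u _ -> _ //].
Qed.

Lemma repr_barcode_eq s : barcode_eq (repr (\pi_(barcode R) s)) s.
Proof. by have /eqmodP := reprK (\pi_(barcode R) s). Qed.

Lemma perm_bars s t : perm_eq s t ->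
  exists f : 'I_(size s) -> 'I_(size t),
    bijective f /\ forall i, bars (f i) = bars i.
Proof.
move=> st; have szst := perm_size st.
have /tuple_permP [p sE] : perm_eq s (in_tuple t) by [].
have hf (i : 'I_(size s)) : bars (p (cast_ord szst i)) = bars i.
  rewrite (bars_nth (bar0 R) i); set j := cast_ord szst i.
  have -> : i = j :> nat by [].
  rewrite {1}sE (nth_map j) ?size_enum_ord //.
  by rewrite nth_ord_enum.
exists (fun i => p (cast_ord szst i)); split=> //.
exists (fun j => cast_ord (esym szst) (p^-1%g j)) => i.
  by rewrite permK cast_ordK.
by rewrite cast_ordKV permKV.
Qed.

Lemma rcons_bars s I : exists f : 'I_(size s) -> 'I_(size (rcons s I)),
  [/\ injective f, forall i, bars (f i) = bars i
    & forall j, j \notin codom f -> bars j = I].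
Proof.
have h : (size s <= size (rcons s I))%N by rewrite size_rcons.
exists (widen_ord h); split.
- by move=> i j [] /val_inj.
- move=> i; rewrite !(bars_nth (bar0 R)) /= nth_rcons ltn_ord //.
- move=> j hj; rewrite (bars_nth (bar0 R)) nth_rcons.
  case: ltnP => [js|sj].
    by case/codomP: hj; exists (Ordinal js); apply: val_inj.
  have js : (j <= size s)%N by rewrite -ltnS (leq_trans (ltn_ord j)) ?size_rcons.
  by rewrite eqn_leq js sj.
Qed.

Lemma dinfty_sym I J : dinfty I J = dinfty J I.
Proof.
by rewrite /dinfty distrC; congr Num.max; rewrite -normrN; congr `|_|; ring.
Qed.

Lemma dinfty_ge0 I J : 0 <= dinfty I J.
Proof. by rewrite le_max normr_ge0. Qed.

Lemma dinfty_diag_ge0 I : 0 <= dinfty_diag I.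
Proof. by rewrite divr_ge0 // /len. Qed.

Lemma dinfty_ge_diag I J : len I = 0 -> dinfty_diag J <= dinfty I J.
Proof.
move=> I0; rewrite /dinfty /dinfty_diag I0 le_max.
have J0 : 0 <= len J by rewrite /len.
have [//|h] := lerP (len J / 2) `|left_end I - left_end J|; rewrite /=.
move: h; rewrite ltr_norml => /andP[h1 h2].
by rewrite ler_normr; apply/orP; right; lra.
Qed.

Definition swap_pair (A B : Type) (ab : A * B) := (ab.2, ab.1).

Lemma swap_pairK (A B : Type) : cancel (@swap_pair A B) (@swap_pair B A).
Proof. by case. Qed.

Lemma partial_bij_swap (A B : finType) (th : {set A * B}) :
  partial_bij th -> partial_bij (@swap_pair A B @: th).
Proof.
by case=> h1 h2; split=> _ _ /imsetP[x xth ->] /imsetP[y yth ->] /= e;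
  congr swap_pair; [apply: h2|apply: h1].
Qed.

Lemma matching_cost_swap (q : R) (A B : finType) (I : A -> bar R)
    (J : B -> bar R) (th : {set A * B}) :
  matching_cost q J I (@swap_pair A B @: th) = matching_cost q I J th.
Proof.
rewrite /matching_cost big_imset /=; last first.
  by move=> x y _ _; apply: (can_inj (@swap_pairK A B)).
rewrite -addrA [X in _ + X]addrC addrA; congr (_ + _ + _).
- by apply: eq_bigr => ab _; rewrite dinfty_sym.
- by rewrite -imset_comp.
- by rewrite -imset_comp.
Qed.

Lemma min_cost_le (q : R) (A B : finType) (I : A -> bar R) (J : B -> bar R)
    (A' B' : finType) (I' : A' -> bar R) (J' : B' -> bar R) :
  (forall th, partial_bij th -> exists2 th', partial_bij th' &
     matching_cost q I' J' th' <= matching_cost q I J th) ->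
  (\big[Num.min/matching_cost q I' J' set0]_(th : {set A' * B'}
      | `[< partial_bij th >]) matching_cost q I' J' th) <=
  (\big[Num.min/matching_cost q I J set0]_(th : {set A * B}
      | `[< partial_bij th >]) matching_cost q I J th).
Proof.
move=> H.
have H' th : partial_bij th -> \big[Num.min/matching_cost q I' J' set0]_(th
      | `[< partial_bij th >]) matching_cost q I' J' th
      <= matching_cost q I J th.
  move=> /H [th' bth']; apply: le_trans.
  by apply: bigmin_le_cond; apply/asboolP.
apply: (big_ind (fun x => _ <= x)).
- by apply: H'; split=> ? ?; rewrite inE.
- by move=> x y hx hy; rewrite le_min hx.
- by move=> th /asboolP /H'.
Qed.

Lemma wasserstein_fam_sym (q : R) (A B : finType) (I : A -> bar R)
    (J : B -> bar R) : wasserstein_fam q I J = wasserstein_fam q J I.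
Proof.
congr (_ `^ _); apply/eqP; rewrite eq_le; apply/andP; split;
 apply: min_cost_le => th bth; exists (@swap_pair _ _ @: th);
 by [apply: partial_bij_swap | rewrite matching_cost_swap].
Qed.

Lemma wasserstein_fam_ext (q : R) (A A' B : finType) (f : A -> A')
    (I : A -> bar R) (I' : A' -> bar R) (J : B -> bar R) :
  1 <= q -> injective f -> (forall a, I' (f a) = I a) ->
  (forall a', a' \notin codom f -> len (I' a') = 0) ->
  wasserstein_fam q I J = wasserstein_fam q I' J.
Proof.
move=> q1 fI II' I'0; have q0 : q != 0 by rewrite gt_eqF // (lt_le_trans ltr01).
have pq0 (x : R) : 0 <= x `^ q by exact: powR_ge0.
pose g (ab : A * B) := (f ab.1, ab.2).
have gI : injective g by case=> a b [a' b'] [/fI -> ->].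
have splitA' (P : pred A') : \sum_(a' | P a') dinfty_diag (I' a') `^ q =
    \sum_(a | P (f a)) dinfty_diag (I a) `^ q.
  rewrite (bigID (mem (codom f))) /= [X in _ + X]big1 ?addr0; last first.
    by move=> a' /andP[_ /I'0]; rewrite /dinfty_diag => ->; rewrite mul0r powR0.
  transitivity (\sum_(a' in f @: [set a | P (f a)]) dinfty_diag (I' a') `^ q).
    apply: eq_bigl => a'; apply/andP/imsetP.
      by case=> Pa' /codomP[a aE]; exists a => //; rewrite inE -aE.
    by case=> a; rewrite inE => Pa ->; split=> //; apply: codom_f.
  rewrite big_imset /=; last by move=> ? ? _ _ /fI.
  by apply: eq_big => a; rewrite ?inE // II'.
congr (_ `^ _); apply/eqP; rewrite eq_le; apply/andP; split;
 apply: min_cost_le => th [th1 th2].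
- exists (g @^-1: th).
    split=> -[a b] [a' b']; rewrite !inE /= => h h' e.
      by apply: gI; apply: th1 => //=; rewrite e.
    by apply: gI; apply: th2.
  rewrite /matching_cost splitA'.
  have fstE a : (f a \notin fst @: th) = (a \notin fst @: (g @^-1: th)).
    congr negb; apply/imsetP/imsetP.
      by case=> -[a' b] h /= e; exists (a, b) => //; rewrite inE /g /= e.
    by case=> -[a' b]; rewrite inE => h /= ->; exists (g (a', b)).
  rewrite (eq_bigl _ _ fstE).
  rewrite (bigID (mem (codom g)) (mem th)) /=.
  rewrite -!addrA; apply: lerD.
    rewrite le_eqVlt; apply/orP; left; apply/eqP.
    transitivity (\sum_(ab in g @: (g @^-1: th)) dinfty (I' ab.1) (J ab.2) `^ q).
      rewrite big_imset /=; last by move=> ? ? _ _ /gI.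
      by apply: eq_bigr => ab _; rewrite II'.
    apply: eq_bigl => ab; apply/imsetP/andP.
      by case=> x; rewrite inE => h ->; split=> //; apply: codom_f.
    by case=> h /codomP[x xE]; exists x => //; rewrite inE -xE.
  rewrite addrCA; apply: lerD => //.
  rewrite (bigID (mem (snd @: th))) /=; apply: lerD; last first.
    rewrite le_eqVlt; apply/orP; left; apply/eqP; apply: eq_bigl => b.
    apply/andP/idP => [[]//|h]; split=> //.
    apply: contra h => /imsetP[x]; rewrite inE => h ->.
    by apply/imsetP; exists (g x).
  apply: (@le_trans _ _ (\sum_(b in snd @: [set ab in th | ab \notin codom g])
     dinfty_diag (J b) `^ q)).
    rewrite le_eqVlt; apply/orP; left; apply/eqP; apply: eq_bigl => b.
    apply/andP/imsetP.
      case=> hb /imsetP[x xth bE]; exists x => //; rewrite inE xth.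
      apply: contra hb => /codomP[y yE]; apply/imsetP; exists y.
        by rewrite inE -yE.
      by rewrite bE yE.
    case=> x; rewrite inE => /andP[xth xg] ->; split; last first.
      by apply/imsetP; exists x.
    apply/imsetP => -[y]; rewrite inE => gy e.
    have := th2 _ _ xth gy e => xE.
    by move: xg; rewrite xE codom_f.
  rewrite big_imset /=; last first.
    by move=> x y; rewrite !inE => /andP[hx _] /andP[hy _]; apply: th2.
  rewrite (eq_bigl (fun ab => (ab \in th) && (ab \notin codom g))); last first.
    by move=> x; rewrite inE.
  apply: ler_sum => -[a b] /andP[_ h].
  rewrite ge0_ler_powR ?nnegrE ?dinfty_ge0 ?dinfty_diag_ge0 //.
    by rewrite (le_trans ler01).
  apply: dinfty_ge_diag; apply: I'0; apply: contra h => /codomP[a' /= ->].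
  by apply/codomP; exists (a', b).
- exists (g @: th).
    split=> _ _ /imsetP[x xth ->] /imsetP[y yth ->] /=.
      by move=> /fI e; congr g; apply: th1.
    by move=> e; congr g; apply: th2.
  rewrite le_eqVlt; apply/orP; left; apply/eqP.
  rewrite /matching_cost splitA' big_imset /=; last by move=> ? ? _ _ /gI.
  congr (_ + _ + _).
  + by apply: eq_bigr => ab _; rewrite II'.
  + apply: eq_bigl => a; congr negb; apply/imsetP/imsetP.
      by case=> _ /imsetP[x xth ->] /= /fI ->; exists x.
    by case=> x xth ->; exists (g x) => //; apply: imset_f.
  + by rewrite -imset_comp.
Qed.

Lemma wasserstein_step (q : R) (B : finType) (J : B -> bar R) s t :
  1 <= q -> barcode_step s t ->
  wasserstein_fam q (@bars R s) J = wasserstein_fam q (@bars R t) J.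
Proof.
move=> q1 []{s t}.
  move=> s t /perm_bars[f [[g fK gK] fE]].
  apply: (wasserstein_fam_ext (f := f)) => //; first exact: can_inj fK.
  by move=> a' /codomP[]; exists (g a').
move=> s I I0; apply/esym; have [f [fI fE fN]] := rcons_bars s I.
by apply: (wasserstein_fam_ext (f := f)) => // a' /fN ->.
Qed.

Lemma wassersteinE (q : R) s t : 1 <= q ->
  wasserstein q (\pi_(barcode R) s) (\pi_(barcode R) t)
  = wasserstein_fam q (@bars R s) (@bars R t).
Proof.
move=> q1; rewrite /wasserstein.
rewrite (barcode_eq_lift (f := fun s => wasserstein_fam q (@bars R s) _) _
  (repr_barcode_eq s)); last by move=> ? ?; apply: wasserstein_step.
rewrite wasserstein_fam_sym.
rewrite (barcode_eq_lift (f := fun s => wasserstein_fam q (@bars R s) _) _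
  (repr_barcode_eq t)); last by move=> ? ?; apply: wasserstein_step.
exact: wasserstein_fam_sym.
Qed.

Lemma sigma_val_le n (e : 'M[bool]_(n, 2)) (y d : 'I_n -> R) p :
  sigma_val e y d p <= sigma e y d.
Proof. exact: le_bigmax. Qed.

Lemma sigma_le n n' (e : 'M[bool]_(n, 2)) (e' : 'M[bool]_(n', 2))
    (y d : 'I_n -> R) (y' d' : 'I_n' -> R) :
  (forall p, exists p', sigma_val e y d p <= sigma_val e' y' d' p') ->
  sigma e y d <= sigma e' y' d'.
Proof.
move=> H; have H' p : sigma_val e y d p <= sigma e' y' d'.
  by have [p' /le_trans -> //] := H p; apply: sigma_val_le.
by apply: (big_ind (fun x => x <= sigma e' y' d')) => // a b ha hb; rewrite ge_max ha.
Qed.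

Lemma sigma_perm n (e : 'M[bool]_(n, 2)) (y d : 'I_n -> R) (p : 'S_n) :
  sigma e (y \o p) (d \o p) = sigma e y d.
Proof.
have le (y' d' : 'I_n -> R) (r : 'S_n) :
    sigma e (y' \o r) (d' \o r) <= sigma e y' d'.
  apply: sigma_le => r'; exists (r^-1 * r')%g.
  rewrite /sigma_val [leRHS](reindex_inj (@perm_inj _ r)) /=.
  by under [leRHS]eq_bigr do rewrite permM permK.
apply/eqP; rewrite eq_le le /=.
have := le (y \o p) (d \o p) (p^-1)%g; congr (_ <= _).
by congr sigma; apply/funext => i /=; rewrite permKV.
Qed.

Lemma sigma_eq n (e : 'M[bool]_(n, 2)) (y d y' d' : 'I_n -> R) :
  y =1 y' -> d =1 d' -> sigma e y d = sigma e y' d'.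
Proof. by move=> /funext -> /funext ->. Qed.

Lemma sigma_drop n (e : 'M[bool]_(n, 2)) (e' : 'M[bool]_(n.+1, 2))
    (y d : 'I_n -> R) (y' d' : 'I_n.+1 -> R) :
  (forall i j, e' (lift ord_max i) j = e i j) ->
  (forall j, e' ord_max j = false) ->
  (forall i, y' (lift ord_max i) = y i) -> y' ord_max = 0 ->
  (forall i, d' (lift ord_max i) = d i) -> d' ord_max = 0 ->
  (forall i, 0 <= y i) -> (forall i, 0 <= d i) ->
  sigma e' y' d' = sigma e y d.
Proof.
move=> el e0 yl y0 dl d0 yge dge.
have liftE p : sigma_val e' y' d' (lift_perm ord_max ord_max p) =
    sigma_val e y d p.
  rewrite /sigma_val (bigD1_ord ord_max) //= lift_perm_id !e0 !mul0r !add0r.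
  by apply: eq_bigr => i _; rewrite lift_perm_lift !el yl dl.
have y'ge i : 0 <= y' i by case: (unliftP ord_max i) => [j|] ->; rewrite ?yl ?y0.
have d'ge i : 0 <= d' i by case: (unliftP ord_max i) => [j|] ->; rewrite ?dl ?d0.
apply/eqP; rewrite eq_le; apply/andP; split; apply: sigma_le => p; last first.
  by exists (lift_perm ord_max ord_max p); rewrite liftE.
pose j := (p^-1)%g ord_max; pose r := (tperm j ord_max * p)%g.
have r_max : r ord_max = ord_max by rewrite permM tpermR permKV.
pose h i := odflt i (unlift ord_max (r (lift ord_max i))).
have hE i : lift ord_max (h i) = r (lift ord_max i).
  rewrite /h; case: unliftP => [k -> //|/= e1].
  have /perm_inj/eqP : r (lift ord_max i) = r ord_max by rewrite r_max.
  by rewrite eq_sym (negbTE (neq_lift _ _)).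
have hI : injective h.
  move=> i i' /(congr1 (lift ord_max)); rewrite !hE => /perm_inj.
  exact: lift_inj.
exists (perm hI); rewrite -liftE.
have -> : lift_perm ord_max ord_max (perm hI) = r.
  apply/permP => i; case: (unliftP ord_max i) => [k|] ->.
    by rewrite lift_perm_lift permE hE.
  by rewrite lift_perm_id r_max.
apply: ler_sum => i _.
have [->|ij] := eqVneq i j.
  by rewrite permKV !e0 !mul0r addr0 addr_ge0 // mulr_ge0.
have [->|imax] := eqVneq i ord_max; first by rewrite y0 d0 !mulr0.
by rewrite permM tpermD // eq_sym.
Qed.

Section Etuple.
Variables (m k l p : nat).

Let G n (t : n.-tuple (bar R)) : R :=
  Ecoord m (emx n k l p) (fun i => left_end (tnth t i))
    (fun i => len (tnth t i)).

Let Gseq n (t : n.-tuple (bar R)) : G (in_tuple t) = G t.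
Proof.
case: t => u su /=; have e := eqP su; subst n.
by congr G; apply: val_inj.
Qed.

Let Gext n (t t' : n.-tuple (bar R)) :
  (forall i, Num.min (left_end (tnth t i)) (m%:R * len (tnth t i)) =
     Num.min (left_end (tnth t' i)) (m%:R * len (tnth t' i))) ->
  (forall i, len (tnth t i) = len (tnth t' i)) -> G t = G t'.
Proof. by move=> h1 h2; apply: sigma_eq. Qed.

Lemma Eseq_step s t : barcode_step s t -> Eseq m k l p s = Eseq m k l p t.
Proof.
have Gperm u v : perm_eq u v -> G (in_tuple u) = G (in_tuple v).
  move=> uv; have /tuple_permP [r uE] : perm_eq u (in_tuple v) by [].
  pose u' : (size v).-tuple (bar R) := [tuple tnth (in_tuple v) (r i) | i < _].
  have -> : u = u' by [].
  rewrite (Gseq u').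
  rewrite /G /Ecoord.
  under [X in sigma _ X _]funext do rewrite tnth_mktuple.
  under [X in sigma _ _ X]funext do rewrite tnth_mktuple.
  exact: (sigma_perm _ (fun i => Num.min (left_end (tnth (in_tuple v) i))
    (m%:R * len (tnth (in_tuple v) i)))).
case=> {s t} [s t st|s I I0].
  apply: Gperm; rewrite /pad (perm_size st); exact: perm_cat.
have min0 (x : bar R) : len x = 0 -> Num.min (left_end x) (m%:R * len x) = 0.
  by move=> ->; rewrite mulr0 min_r // /left_end.
rewrite /Eseq -/(G (in_tuple (pad (k + l + p) (rcons s I)))).
rewrite -/(G (in_tuple (pad (k + l + p) s))).
have [sN|Ns] := ltnP (size s) (k + l + p).
  rewrite /pad size_rcons subnS; case E1 : (k + l + p - size s)%N => [|c].
    by move: sN; rewrite -subn_gt0 E1.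
  rewrite /= cat_rcons.
  have sz : size (s ++ I :: nseq c (bar0 R)) == size (s ++ bar0 R :: nseq c (bar0 R)).
    by rewrite !size_cat /= .
  rewrite -(Gseq (in_tuple (s ++ bar0 R :: nseq c (bar0 R)))).
  have -> : G (in_tuple (s ++ I :: nseq c (bar0 R))) = G (Tuple sz).
    exact: (Gseq (Tuple sz)).
  have nthE (i : nat) : let x := nth (bar0 R) (s ++ I :: nseq c (bar0 R)) i in
     let x' := nth (bar0 R) (s ++ bar0 R :: nseq c (bar0 R)) i in
     x = x' \/ len x = 0 /\ len x' = 0.
    rewrite /= !nth_cat; case: ltnP => _; first by left.
    by case: (i - size s)%N => [|?] /=; [right|left].
  apply: Gext => i; rewrite !(tnth_nth (bar0 R)) /=; have /= := nthE i.
    by case=> [->//|[h h']]; rewrite !min0.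
  by case=> [->//|[-> ->]].
rewrite /pad size_rcons.
have /eqP -> : (k + l + p - (size s).+1 == 0)%N by rewrite subn_eq0 ltnW.
have /eqP -> : (k + l + p - size s == 0)%N by rewrite subn_eq0.
rewrite !cats0.
pose w := [tuple of rcons (in_tuple s) I].
have -> : G (in_tuple (rcons s I)) = G w by apply: (Gseq w).
have lm (i : 'I_(size s)) : lift ord_max i = i :> nat by rewrite lift_max.
have wl (i : 'I_(size s)) : tnth w (lift ord_max i) = tnth (in_tuple s) i.
  by rewrite !(tnth_nth (bar0 R)) lm /= nth_rcons ltn_ord.
have wmax : tnth w ord_max = I.
  by rewrite (tnth_nth (bar0 R)) /= nth_rcons ltnn eqxx.
apply: sigma_drop.
- by move=> i j; rewrite !mxE lm.
- move=> j; rewrite mxE /= !ltnNge Ns.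
  by rewrite !(leq_trans _ Ns) // ?leq_addr // -addnA leq_addr.
- by move=> i; rewrite wl.
- by rewrite wmax min0.
- by move=> i; rewrite wl.
- by rewrite wmax.
- by move=> i; rewrite le_min; apply/andP; split; rewrite ?mulr_ge0 // /left_end /len.
- by move=> i; rewrite /len.
Qed.

Lemma EfunE s : Efun m k l p (\pi_(barcode R) s) = Eseq m k l p s.
Proof. exact: (barcode_eq_lift Eseq_step (repr_barcode_eq s)). Qed.

End Etuple.

End Welldef.

(* Main.v *)
(* Pad two barcodes by zero-length intervals so that a given matching becomes
   the index-by-index correspondence between two sequences of equal length, an
   unmatched interval being paired with (0,0).  If the cost of the matching is
   delta ^ q, every pair is delta-close, and the coordinates min(x, m d) and d
   of its members differ by at most 2 m delta.  For each permutation the two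
   sums defining E then differ in at most k + l + p rows, a number that does not
   depend on the barcodes, so E is Lipschitz; maxima, sums and differences
   preserve this. *)
Require Import Defs.
From mathcomp Require Import all_boot all_order all_algebra.
From mathcomp Require Import all_fingroup generic_quotient interval_inference.
From mathcomp Require Import boolp reals exp.
From mathcomp Require Import lra.
From Stdlib Require Import Relation_Operators.
Set Implicit Arguments.
Unset Strict Implicit.
Unset Printing Implicit Defensive.
Import Order.TTheory GRing.Theory Num.Theory.
Local Open Scope ring_scope.

(** * Distances between minima and between maxima *)

Lemma distr_min_le {R : realDomainType} (a b c d e : R) :
  `|a - c| <= e -> `|b - d| <= e -> `|Num.min a b - Num.min c d| <= e.
Proof.
rewrite !ler_norml => /andP[? ?] /andP[? ?].
by case: (leP a b) => ?; case: (leP c d) => ?; apply/andP; split; lra.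
Qed.

Lemma distr_max_leD {R : realDomainType} (a b c d : R) :
  `|Num.max a b - Num.max c d| <= `|a - c| + `|b - d|.
Proof.
have := ler_norm (a - c); have := ler_norm (c - a).
have := ler_norm (b - d); have := ler_norm (d - b).
rewrite (distrC c) (distrC d) ler_norml => ? ? ? ?.
have := normr_ge0 (a - c); have := normr_ge0 (b - d) => ? ?.
by case: (leP a b) => ?; case: (leP c d) => ?; apply/andP; split; lra.
Qed.

(** * Closeness of the coordinates of two intervals *)

Section Coordinates.
Variable R : realType.
Implicit Types (I J : bar R) (s t : seq (bar R)).

Definition ycoord (m : nat) I : R := Num.min (left_end I) (m%:R * len I).

Definition coord_close (m : nat) (c : R) I J : Prop :=
  `|ycoord m I - ycoord m J| <= c /\ `|len I - len J| <= c.

Lemma len_ge0 I : 0 <= len I. Proof. by rewrite /len. Qed.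

Lemma left_end_ge0 I : 0 <= left_end I. Proof. by rewrite /left_end. Qed.

Lemma len_bar0 : len (bar0 R) = 0. Proof. by []. Qed.

Lemma left_end_bar0 : left_end (bar0 R) = 0. Proof. by []. Qed.

Lemma coord_closeC m c I J : coord_close m c I J -> coord_close m c J I.
Proof. by case=> h1 h2; split; rewrite distrC. Qed.

(** The length difference is the second entry of [dinfty] minus the difference of left ends, hence
    at most [2 * delta]. Scaling by [m] gives the constant, and [m >= 1] makes it cover the other
    bounds. *)
Lemma coord_close_dinfty m delta I J : (0 < m)%N -> dinfty I J <= delta ->
  coord_close m (2 * m%:R * delta) I J.
Proof.
move=> m0; have m1 : 1 <= m%:R :> R by rewrite ler1n.
rewrite /dinfty ge_max => /andP[hx hy].
have d0 : 0 <= delta by apply: le_trans hx.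
have hd : `|len I - len J| <= 2 * delta.
  by move: hx hy; rewrite !ler_norml => /andP[? ?] /andP[? ?]; apply/andP; split; lra.
have hm : delta <= m%:R * delta by rewrite ler_peMl.
split; last by apply: le_trans hd _; lra.
apply: distr_min_le; first by apply: le_trans hx _; lra.
rewrite -mulrBr normrM ger0_norm // [2 * _]mulrC -mulrA.
by rewrite ler_wpM2l.
Qed.

(** The cap [m * len] in [ycoord] forces a short interval to have a small first coordinate wherever
    it starts. So [bar0] can serve as the partner of every unmatched interval. *)
Lemma coord_close_diag m delta I : (0 < m)%N -> dinfty_diag I <= delta ->
  coord_close m (2 * m%:R * delta) I (bar0 R).
Proof.
move=> m0; have m1 : 1 <= m%:R :> R by rewrite ler1n.
rewrite /dinfty_diag => hI; have l0 := len_ge0 I.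
have hm : len I <= m%:R * len I by rewrite ler_peMl.
have hmd : m%:R * (len I / 2) <= m%:R * delta by rewrite ler_wpM2l.
have y0 : 0 <= ycoord m I.
  by rewrite /ycoord le_min left_end_ge0 mulr_ge0.
have y1 : ycoord m I <= m%:R * len I by rewrite /ycoord ge_min lexx orbT.
split; last by rewrite len_bar0 subr0 ger0_norm //; lra.
rewrite [ycoord m (bar0 R)]/ycoord left_end_bar0 len_bar0 mulr0 minxx subr0.
by rewrite ger0_norm //; lra.
Qed.

End Coordinates.

(** * Stability of [Eseq] for sequences that are close index by index *)

Section CommonPadding.
Variable R : realType.
Implicit Types (s t : seq (bar R)).

Lemma Eseq_barcode_eq m k l p s t :
  barcode_eq s t -> Eseq m k l p s = Eseq m k l p t.
Proof. exact: (barcode_eq_lift (@Eseq_step R m k l p)). Qed.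

Lemma barcode_eq_cat_nseq s n : barcode_eq (s ++ nseq n (bar0 R)) s.
Proof.
elim: n => [|n IH]; first by rewrite cats0 barcode_eq_refl.
apply: barcode_eq_trans IH.
(* [BarcodeDrop] removes only a last interval, so the extra [bar0] is moved to the end. *)
have -> : s ++ nseq n.+1 (bar0 R) = rcons (s ++ nseq n (bar0 R)) (bar0 R).
  by rewrite rcons_cat; congr cat; elim: n => //= n ->.
by apply/asboolP; apply: rst_step; apply: BarcodeDrop.
Qed.

Lemma barcode_eq_perm s t : perm_eq s t -> barcode_eq s t.
Proof. by move=> st; apply/asboolP; apply: rst_step; apply: BarcodePerm. Qed.

(* The number of padded intervals is written as an explicit function of [size s]
   so that two sequences of the same size live over the same ordinal. *)
Lemma EseqE m k l p s : let n := (size s + (k + l + p - size s))%N in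
  Eseq m k l p s = sigma (emx n k l p)
    (fun i : 'I_n => ycoord m (nth (bar0 R) s i))
    (fun i : 'I_n => len (nth (bar0 R) s i)).
Proof.
move=> n; rewrite /Eseq /Ecoord /=.
have : n = size (pad (k + l + p) s) by rewrite size_cat size_nseq.
clearbody n => nE; subst n.
(* Since [bar0] is both the padding and the default of [nth], padding is invisible here. *)
have nthE i : nth (bar0 R) (pad (k + l + p) s) i = nth (bar0 R) s i.
  by rewrite nth_cat; case: ltnP => // si; rewrite nth_nseq if_same nth_default.
by apply: sigma_eq => i; rewrite (bars_nth (bar0 R)) nthE.
Qed.

(** Only the first [k + l + p] rows are nonzero, and each contributes at most 2. The bound is thus
    uniform in [n]. *)
Lemma sum_emx_le n k l p : (k + l + p <= n)%N ->
  \sum_(i < n) ((emx n k l p i 0)%:R + (emx n k l p i 1)%:R) <=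
  2 * (k + l + p)%:R :> R.
Proof.
move=> Nn.
have -> : 2 * (k + l + p)%:R = \sum_(i < n | (i < k + l + p)%N) 2 :> R.
  by rewrite -(big_ord_widen n (fun=> 2 : R)) // sumr_const card_ord mulr_natr.
rewrite [leRHS]big_mkcond /=; apply: ler_sum => i _; rewrite !mxE.
case: ltnP => [ik|ki]; first by rewrite ltn_addr ?ltn_addr // addr0 ler1n.
case: ltnP => [ikl|kli]; first by rewrite ltn_addr // add0r ler1n.
by case: ltnP => _ //=; rewrite add0r.
Qed.

Lemma sigma_val_close n (e : 'M[bool]_(n, 2)) (y d y' d' : 'I_n -> R) c r :
  (forall i, `|y i - y' i| <= c) -> (forall i, `|d i - d' i| <= c) ->
  sigma_val e y d r <= sigma_val e y' d' r
    + (\sum_(i < n) ((e i 0)%:R + (e i 1)%:R)) * c.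
Proof.
(* The sum of the entries of [e] is reindexed along [r], which allows a comparison row by row. *)
move=> hy hd; rewrite (reindex_inj (@perm_inj _ r)) /= mulr_suml -big_split /=.
apply: ler_sum => i _.
have := hy i; have := hd i; rewrite !ler_norml => /andP[_ hdi] /andP[_ hyi].
have ey : (e (r i) 0)%:R * y i <= (e (r i) 0)%:R * (y' i + c) :> R.
  by rewrite ler_wpM2l //; lra.
have ed : (e (r i) 1)%:R * d i <= (e (r i) 1)%:R * (d' i + c) :> R.
  by rewrite ler_wpM2l //; lra.
by lra.
Qed.

(** Each permutation is compared with itself on the other side before the maximum is taken. *)
Lemma Eseq_close_le m k l p c s t : 0 <= c -> size s = size t ->
  (forall i, coord_close m c (nth (bar0 R) s i) (nth (bar0 R) t i)) ->
  Eseq m k l p s <= Eseq m k l p t + 2 * (k + l + p)%:R * c.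
Proof.
move=> c0 st H; rewrite !EseqE st.
set n := (size t + _)%N; set y' := (X in _ <= sigma _ X _ + _).
set d' := (X in _ <= sigma _ _ X + _).
have Nn : (k + l + p <= n)%N by rewrite -leq_subLR.
have Hr r : sigma_val (emx n k l p) (fun i => ycoord m (nth (bar0 R) s i))
    (fun i => len (nth (bar0 R) s i)) r
    <= sigma (emx n k l p) y' d' + 2 * (k + l + p)%:R * c.
  apply: le_trans (@sigma_val_close _ _ _ _ y' d' c r _ _) _ => [i|i|].
  - by case: (H i).
  - by case: (H i).
  by apply: lerD; [apply: sigma_val_le | rewrite ler_wpM2r // sum_emx_le].
exact: bigmax_le.
Qed.

Lemma Eseq_close m k l p c s t : 0 <= c -> size s = size t ->
  (forall i, coord_close m c (nth (bar0 R) s i) (nth (bar0 R) t i)) ->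
  `|Eseq m k l p s - Eseq m k l p t| <= 2 * (k + l + p)%:R * c.
Proof.
move=> c0 st H; rewrite ler_distlC lerBlDr; apply/andP; split.
  exact: Eseq_close_le.
by apply: Eseq_close_le => // i; apply: coord_closeC.
Qed.

End CommonPadding.

(** * From a partial matching to an index-by-index comparison *)

Section Matching.
Variable R : realType.

(** Injectivity on [th] lists each matched element once; the unmatched ones complete the
    enumeration. It is applied to both projections of a matching. *)
Lemma perm_enum_partial (A D : finType) (f : D -> A) (th : {set D}) :
  {in th &, injective f} ->
  perm_eq ([seq f x | x <- enum th] ++ enum [set a | a \notin f @: th]) (enum A).
Proof.
move=> fI; apply: uniq_perm; last 2 first.
- exact: enum_uniq.
- move=> a; rewrite mem_cat !mem_enum inE [RHS]inE.
  suff -> : (a \in [seq f x | x <- enum th]) = (a \in f @: th) by rewrite orbN.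
  apply/mapP/imsetP => -[x]; first by rewrite mem_enum => xth ->; exists x.
  by move=> xth ->; exists x; rewrite ?mem_enum.
rewrite cat_uniq enum_uniq andbT; apply/andP; split.
  by rewrite map_inj_in_uniq ?enum_uniq // => x y; rewrite !mem_enum; apply: fI.
apply/hasPn => a; rewrite mem_enum inE => ha; apply: contra ha.
by case/mapP=> x; rewrite mem_enum => xth ->; apply: imset_f.
Qed.

Lemma map_bars (s : seq (bar R)) : [seq bars i | i <- enum 'I_(size s)] = s.
Proof. exact: (map_tnth_enum (in_tuple s)). Qed.

(** Here [x] is the [q]-th root of its own [q]-th power, and the root is monotone. *)
Lemma powR_le_root (q x c : R) : 1 <= q -> 0 <= x -> x `^ q <= c ->
  x <= c `^ q^-1.
Proof.
move=> q1 x0 h; have q0 : 0 < q by apply: lt_le_trans q1.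
rewrite -[leLHS](powRr1 x0) -(mulfV (lt0r_neq0 q0)) powRrM.
by rewrite ge0_ler_powR ?nnegrE ?powR_ge0 ?invr_ge0 ?(ltW q0) // (le_trans _ h) ?powR_ge0.
Qed.

Section Cost.
Variables (q : R) (A B : finType) (I : A -> bar R) (J : B -> bar R).
Variable th : {set A * B}.
Let cost : R := matching_cost q I J th.

Let sum_ge0 (T : finType) (P : pred T) (f : T -> R) :
  0 <= \sum_(x | P x) f x `^ q.
Proof. by apply: sumr_ge0 => x _; apply: powR_ge0. Qed.

Let term_le_sum (T : finType) (P : pred T) (f : T -> R) x : P x ->
  f x `^ q <= \sum_(x | P x) f x `^ q.
Proof. by move=> Px; rewrite (bigD1 x) //= lerDl sum_ge0. Qed.

(** All terms of the cost are nonnegative, so the total dominates each one. The next two lemmas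
    treat the diagonal terms in the same way. *)
Lemma dinfty_le_cost ab : ab \in th -> dinfty (I ab.1) (J ab.2) `^ q <= cost.
Proof.
move=> h; rewrite /cost /matching_cost -addrA.
rewrite (le_trans (@term_le_sum _ (mem th)
  (fun ab => dinfty (I ab.1) (J ab.2)) ab h)) //.
by rewrite lerDl addr_ge0 ?sum_ge0.
Qed.

Lemma diagl_le_cost a : a \notin fst @: th -> dinfty_diag (I a) `^ q <= cost.
Proof.
move=> h; rewrite /cost /matching_cost addrAC.
rewrite (le_trans (@term_le_sum _ (fun a => a \notin fst @: th)
  (fun a => dinfty_diag (I a)) a h)) //.
by rewrite lerDr addr_ge0 ?sum_ge0.
Qed.

Lemma diagr_le_cost b : b \notin snd @: th -> dinfty_diag (J b) `^ q <= cost.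
Proof.
move=> h; rewrite /cost /matching_cost.
rewrite (le_trans (@term_le_sum _ (fun b => b \notin snd @: th)
  (fun b => dinfty_diag (J b)) b h)) //.
by rewrite lerDr addr_ge0 ?sum_ge0.
Qed.

End Cost.

(** The minimum is over a finite family, and its default value is the cost of [set0], itself a
    partial bijection. *)
Lemma wasserstein_fam_attained (q : R) (A B : finType) (I : A -> bar R)
    (J : B -> bar R) :
  exists2 th, partial_bij th &
    wasserstein_fam q I J = matching_cost q I J th `^ q^-1.
Proof.
rewrite /wasserstein_fam; set w := \big[_/_]_(_ | _) _.
suff [th bth ->] : exists2 th, partial_bij th & w = matching_cost q I J th.
  by exists th.
rewrite {}/w; apply: (big_ind (fun x => exists2 th, partial_bij th &
  x = matching_cost q I J th)).
- by exists set0 => //; split=> ? ?; rewrite inE.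
- by move=> x y hx hy; case: leP.
- by move=> th /asboolP bth; exists th.
Qed.

Lemma Eseq_matching m k l p (q : R) (s t : seq (bar R))
    (th : {set 'I_(size s) * 'I_(size t)}) :
  1 <= q -> (0 < m)%N -> partial_bij th ->
  `|Eseq m k l p s - Eseq m k l p t| <=
  2 * (k + l + p)%:R * (2 * m%:R)
    * matching_cost q (@bars R s) (@bars R t) th `^ q^-1.
Proof.
move=> q1 m0 [th1 th2]; set delta := _ `^ _.
pose I := @bars R s; pose J := @bars R t.
pose uA := enum [set a | a \notin fst @: th].
pose uB := enum [set b | b \notin snd @: th].
(* Both sequences have three aligned blocks: matched pairs, unmatched intervals of [s] against
   [bar0], and [bar0] against unmatched intervals of [t]. *)
pose u := [seq I x.1 | x <- enum th] ++ map I uA ++ nseq (size uB) (bar0 R).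
pose v := [seq J x.2 | x <- enum th] ++ nseq (size uA) (bar0 R) ++ map J uB.
have su : barcode_eq u s.
  rewrite /u catA; apply: barcode_eq_trans (barcode_eq_cat_nseq _ _) _.
  apply: barcode_eq_perm; rewrite -[X in perm_eq _ X]map_bars.
  by rewrite (map_comp I) -map_cat; apply: perm_map; apply: perm_enum_partial.
have tv : barcode_eq v t.
  (* In [v] the [bar0] block is in the middle; it is permuted to the end before being dropped. *)
  apply: (@barcode_eq_trans _ (([seq J x.2 | x <- enum th] ++ map J uB)
      ++ nseq (size uA) (bar0 R))).
    by apply: barcode_eq_perm; rewrite -catA perm_cat2l perm_catC.
  apply: barcode_eq_trans (barcode_eq_cat_nseq _ _) _.
  apply: barcode_eq_perm; rewrite -[X in perm_eq _ X]map_bars.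
  by rewrite (map_comp J) -map_cat; apply: perm_map; apply: perm_enum_partial.
rewrite -(Eseq_barcode_eq _ _ _ _ su) -(Eseq_barcode_eq _ _ _ _ tv).
have d0 : 0 <= delta by apply: powR_ge0.
have c0 : 0 <= 2 * m%:R * delta by rewrite !mulr_ge0.
rewrite -mulrA; apply: Eseq_close => //.
  by rewrite !size_cat !size_map !size_nseq.
(* Zipping [u] and [v] into one list of pairs reduces closeness at each index to membership in one
   of the three blocks. *)
pose w := [seq (I x.1, J x.2) | x <- enum th]
  ++ [seq (I a, bar0 R) | a <- uA] ++ [seq (bar0 R, J b) | b <- uB].
have map_cst (T : Type) (x : seq T) : map (fun=> bar0 R) x = nseq (size x) (bar0 R).
  by elim: x => //= _ x ->.
have -> : u = unzip1 w by rewrite /unzip1 !map_cat -!map_comp map_cst.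
have -> : v = unzip2 w by rewrite /unzip2 !map_cat -!map_comp map_cst.
have W : forall x, x \in w -> coord_close m (2 * m%:R * delta) x.1 x.2.
  move=> x; rewrite !mem_cat => /or3P[] /mapP[z].
  - rewrite mem_enum => zth -> /=; apply: coord_close_dinfty => //.
    by apply: powR_le_root; rewrite ?dinfty_ge0 ?dinfty_le_cost.
  - rewrite mem_enum inE => hz -> /=; apply: coord_close_diag => //.
    by apply: powR_le_root; rewrite ?dinfty_diag_ge0 ?diagl_le_cost.
  - rewrite mem_enum inE => hz -> /=; apply/coord_closeC/coord_close_diag => //.
    by apply: powR_le_root; rewrite ?dinfty_diag_ge0 ?diagr_le_cost.
move=> i; have [iw|wi] := ltnP i (size w).
  rewrite /unzip1 /unzip2 !(nth_map (bar0 R, bar0 R)) //.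
  by apply: W; rewrite mem_nth.
(* Past the end, both entries are the default [bar0]. *)
by rewrite !nth_default ?size_map //; split; rewrite subrr normr0.
Qed.

(** [Efun] and [wasserstein] use the same representatives, so the bound for an optimal matching
    applies directly. *)
Lemma Efun_lipschitz m k l p (q : R) (b1 b2 : barcode R) : 1 <= q -> (0 < m)%N ->
  `|Efun m k l p b1 - Efun m k l p b2| <=
  2 * (k + l + p)%:R * (2 * m%:R) * wasserstein q b1 b2.
Proof.
move=> q1 m0; rewrite /Efun /wasserstein.
have [th bth ->] := wasserstein_fam_attained q (@bars R (repr b1))
  (@bars R (repr b2)).
exact: Eseq_matching.
Qed.

End Matching.

Theorem theorem7p3 (R : realType) (q : R) (F : barcode R -> R) :
  1 <= q -> in_G F ->
  exists C : R, forall b1 b2 : barcode R,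
    `|F b1 - F b2| <= C * wasserstein q b1 b2.
Proof.
move=> q1; elim=> {F} [m k l p m0 _|F1 F2 _ [C1 H1] _ [C2 H2]
  |F1 F2 _ [C1 H1] _ [C2 H2]|F1 F2 _ [C1 H1] _ [C2 H2]].
- by eexists => b1 b2; apply: Efun_lipschitz.
(* One constant serves maxima, sums and differences: each changes by at most the sum of the changes
   of [F1] and [F2]. *)
all: exists (C1 + C2) => b1 b2; rewrite mulrDl.
all: apply: le_trans (lerD (H1 b1 b2) (H2 b1 b2)).
- exact: distr_max_leD.
- by rewrite opprD addrACA ler_normD.
- by rewrite opprD addrACA -opprD ler_normB.
Qed.
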